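(* (i) For every vector field $X\in\mathfrak{X}^1(\mathbb{S}^6)$ one has $\iota_{X\wedge JX}\omega=0$, i.e. for any constant function $H$ the couple $(H,X\wedge JX)$ is a solution of the Hamilton-de Donder-Weyl equation $\iota_{X\wedge JX}\omega=-dH$. (ii) For every decomposable bivector field $Y\in\mathfrak{X}^2(\mathbb{S}^6)$ (i.e. $Y=U\wedge V$ for some vector fields $U,V\in\mathfrak{X}^1(\mathbb{S}^6)$) with $\iota_Y\omega=0$, there exists a vector field $X\in\mathfrak{X}^1(\{Y\neq0\})$ on the open set $\{Y\neq 0\}\subset\mathbb{S}^6$ such that $Y=\pm X\wedge JX$ on $\{Y\neq0\}$, i.e. at each point $p$ of $\{Y\ne0\}$ either $Y_p=X_p\wedge J_pX_p$ or $Y_p=-X_p\wedge J_pX_p$.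
   Context: The octonions $\mathbb{O}$ are the real algebra with vector space basis $e_0,e_1,\dots,e_7$, unit $e_0=1$, and products $e_ie_j=-\delta_{ij}+\sum_{k=1}^7\epsilon_{ijk}e_k$ for $i,j\in\{1,\dots,7\}$, where $\epsilon_{ijk}$ is completely antisymmetric, equal to $1$ for $ijk=123,145,167,246,275,374,365$, and $0$ whenever $(i,j,k)$ is not a permutation of one of these triples. The imaginary octonions (span of $e_1,\dots,e_7$) are identified with $\mathbb{R}^7$ with its standard scalar product $\langle\cdot,\cdot\rangle$. The cross product on $\mathbb{R}^7$ is $u\times v:=\frac12(u\cdot v-v\cdot u)$. The constant-coefficient $3$-form $\widetilde\omega$ on $\mathbb{R}^7$ is $\widetilde\omega(u,v,w)=\langle u\times v,w\rangle$. Let $j:\mathbb{S}^6\hookrightarrow\mathbb{R}^7$ be the inclusion of the unit sphere and $\omega:=j^*\widetilde\omega\in\Omega^3(\mathbb{S}^6)$. The almost complex structure $J$ on $\mathbb{S}^6$ is $J_p(u):=p\times u$ for $p\in\mathbb{S}^6$, $u\in T_p\mathbb{S}^6=p^\perp$. $\mathfrak{X}^k$ denotes $k$-vector fields; contraction is $\iota_{X\wedge Y}=\iota_Y\iota_X$. On a $2$-plectic manifold, a couple $(H,Z)$ of a function and a bivector field solves the Hamilton-de Donder-Weyl equation in dimension two if $\iota_Z\omega=-dH$. *)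

(* Defs.v *)
From mathcomp Require Import all_boot all_order all_algebra.
From mathcomp Require Import all_classical all_reals all_analysis.
Set Implicit Arguments.
Unset Strict Implicit.
Unset Printing Implicit Defensive.
Import Order.TTheory GRing.Theory Num.Theory.
Import numFieldNormedType.Exports.
Local Open Scope classical_set_scope.
Local Open Scope ring_scope.

Section Octonions.
Variable R : realType.

Definition oct_triples : seq (nat * nat * nat) :=
  [:: (1, 2, 3); (1, 4, 5); (1, 6, 7); (2, 4, 6); (2, 7, 5); (3, 7, 4);
      (3, 6, 5)]%N.

Definition oct_cyclic (i j k : nat) : bool :=
  [|| (i, j, k) \in oct_triples, (j, k, i) \in oct_triples
    | (k, i, j) \in oct_triples].

Definition oct_eps (i j k : nat) : R :=
  if oct_cyclic i j k then 1 else if oct_cyclic j i k then - 1 else 0.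

Definition oct_e (i : 'I_8) : 'rV[R]_8 := delta_mx 0 i.

Definition oct_basis_mul (i j : 'I_8) : 'rV[R]_8 :=
  if i == 0 then oct_e j else if j == 0 then oct_e i else
  - (i == j)%:R *: oct_e 0
  + \sum_(k < 8 | k != 0) oct_eps i j k *: oct_e k.

Definition oct_mul (x y : 'rV[R]_8) : 'rV[R]_8 :=
  \sum_(i < 8) \sum_(j < 8) (x 0 i * y 0 j) *: oct_basis_mul i j.

(* Coordinate [i : 'I_7] of R^7 is the coefficient of [e_(i+1)]. *)
Definition oct_of_vec (u : 'rV[R]_7) : 'rV[R]_8 :=
  \row_i (if unlift 0 i is Some k then u 0 k else 0).

Definition oct_im (x : 'rV[R]_8) : 'rV[R]_7 := \row_i x 0 (lift 0 i).

(* [u . v - v . u] is imaginary (see [oct_commE]), so [oct_im] loses nothing. *)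
Definition cross (u v : 'rV[R]_7) : 'rV[R]_7 :=
  oct_im (2^-1 *: (oct_mul (oct_of_vec u) (oct_of_vec v)
                   - oct_mul (oct_of_vec v) (oct_of_vec u))).

Definition dot (u v : 'rV[R]_7) : R := \sum_i u 0 i * v 0 i.

Definition enorm (u : 'rV[R]_7) : R := Num.sqrt (dot u u).

Definition S6 : set 'rV[R]_7 := [set p | enorm p = 1].

Definition tangent (p : 'rV[R]_7) : set 'rV[R]_7 := [set u | dot p u = 0].

(* The pullback of this form to the sphere at [p] is its restriction to
   [tangent p]. *)
Definition omega (u v w : 'rV[R]_7) : R := dot (cross u v) w.

Definition J (p u : 'rV[R]_7) : 'rV[R]_7 := cross p u.

End Octonions.

Section Smooth.
Variables (R : realType) (V W : normedModType R).

(* For open [O] and finite-dimensional [V]: [f] is of class C^n on [O]. *)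
Fixpoint Cn (n : nat) (O : set V) (f : V -> W) : Prop :=
  if n is m.+1 then
    (forall x, O x -> differentiable f x) /\
    (forall v, Cn m O (fun x => 'D_v f x))
  else forall x, O x -> {for x, continuous f}.

(* Only the values of [f] on [A] matter: [f] has smooth local extensions. *)
Definition smooth_on (A : set V) (f : V -> W) : Prop :=
  forall p, A p -> exists (O : set V) (F : V -> W),
    [/\ open O, O p, forall n, Cn n O F & forall x, A x -> O x -> F x = f x].

End Smooth.

Section Fields.
Variable R : realType.
Local Notation vec := 'rV[R]_7.

(* Bivectors of R^7 are encoded as skew-symmetric matrices. *)
Definition wedge (u v : vec) : 'M[R]_7 := u^T *m v - v^T *m u.

Definition tangent_bivector (p : vec) (B : 'M[R]_7) : Prop :=
  exists (n : nat) (u v : 'I_n -> vec),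
    (forall i, tangent p (u i) /\ tangent p (v i)) /\
    B = \sum_(i < n) wedge (u i) (v i).

(* Fields on [A], a subset of the sphere, are functions on R^7 of which only
   the values on [A] are meaningful. *)
Definition vector_field (A : set vec) (X : vec -> vec) : Prop :=
  (forall p, A p -> tangent p (X p)) /\ smooth_on A X.

Definition bivector_field (A : set vec) (Y : vec -> 'M[R]_7) : Prop :=
  (forall p, A p -> tangent_bivector p (Y p)) /\ smooth_on A Y.

Definition decomposable (Y : vec -> 'M[R]_7) : Prop :=
  exists U V : vec -> vec,
    [/\ vector_field (@S6 R) U, vector_field (@S6 R) V
      & forall p, S6 p -> Y p = wedge (U p) (V p)].

(* The linear extension to all bivectors of
   [iota_(u /\ v) omega = omega u v _], see [interior_product_wedge]. *)
Definition interior_product (B : 'M[R]_7) (w : vec) : R :=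
  2^-1 * \sum_i \sum_j B i j * omega (delta_mx 0 i) (delta_mx 0 j) w.

Definition wedgeJ (X : vec -> vec) (p : vec) : 'M[R]_7 :=
  wedge (X p) (J p (X p)).

(* The differential at [p] on [S6] of a function [H] on the sphere, computed
   on the extension of [H] that is constant along rays. *)
Definition dS6 (H : vec -> R) (p w : vec) : R :=
  'D_w (fun x : vec => H ((enorm x)^-1 *: x)) p.

Definition HDW_solution (H : vec -> R) (Z : vec -> 'M[R]_7) : Prop :=
  [/\ smooth_on (@S6 R) H, bivector_field (@S6 R) Z
    & forall p w, S6 p -> tangent p w ->
        interior_product (Z p) w = - dS6 H p w].

End Fields.

Section Facts.
Variable R : realType.
Local Notation vec := 'rV[R]_7.

Lemma oct_commE (u v : vec) :
  2^-1 *: (oct_mul (oct_of_vec u) (oct_of_vec v)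
           - oct_mul (oct_of_vec v) (oct_of_vec u))
  = oct_of_vec (cross u v).
Proof.
apply/rowP => i; rewrite [RHS]mxE; case: unliftP => [j ->|->].
  by rewrite [RHS]mxE.
rewrite 2!mxE; set a := (oct_mul _ _) 0 0.
suff -> : a = oct_mul (oct_of_vec v) (oct_of_vec u) 0 0.
  by rewrite !mxE subrr mulr0.
rewrite /a /oct_mul exchange_big !summxE; apply: eq_bigr => i0 _.
rewrite !summxE; apply: eq_bigr => j _.
rewrite mxE [RHS]mxE ![oct_of_vec _ _ _]mxE /oct_basis_mul.
case: (eqVneq i0 0) => [->|i0N]; first by rewrite unlift_none !(mul0r, mulr0).
case: (eqVneq j 0) => [->|jN]; first by rewrite unlift_none !(mul0r, mulr0).
have coef0 i1 j1 (c : R) : (c *: oct_e R 0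
    + \sum_(k < 8 | k != 0) oct_eps R i1 j1 k *: oct_e R k) 0 0 = c.
  rewrite 3!mxE !eqxx mulr1 summxE big1 ?addr0// => k kN.
  by rewrite !mxE eq_sym (negbTE kN) andbF mulr0.
by rewrite !coef0 eq_sym; congr (_ * _); exact: mulrC.
Qed.

Lemma oct_of_vec_lin a (u v : vec) :
  oct_of_vec (a *: u + v) = a *: oct_of_vec u + oct_of_vec v.
Proof.
apply/rowP => i; rewrite !mxE.
by case: unlift => [j|]; rewrite ?mxE ?mulr0 ?addr0.
Qed.

Lemma oct_mul_linl a (x y z : 'rV[R]_8) :
  oct_mul (a *: x + y) z = a *: oct_mul x z + oct_mul y z.
Proof.
rewrite /oct_mul scaler_sumr -big_split; apply: eq_bigr => i _.
rewrite scaler_sumr -big_split; apply: eq_bigr => j _.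
by rewrite !mxE /= scalerA -scalerDl mulrDl mulrA.
Qed.

Lemma oct_mul_linr a (x y z : 'rV[R]_8) :
  oct_mul z (a *: x + y) = a *: oct_mul z x + oct_mul z y.
Proof.
rewrite /oct_mul scaler_sumr -big_split; apply: eq_bigr => i _.
rewrite scaler_sumr -big_split; apply: eq_bigr => j _.
by rewrite !mxE /= scalerA -scalerDl mulrDr mulrCA.
Qed.

Lemma cross_anti (u v : vec) : cross u v = - cross v u.
Proof. by apply/rowP => i; rewrite /cross !mxE -mulrN opprB. Qed.

Lemma cross_linl a (u v w : vec) :
  cross (a *: u + v) w = a *: cross u w + cross v w.
Proof.
apply/rowP => i; rewrite /cross oct_of_vec_lin oct_mul_linl oct_mul_linr !mxE.
by rewrite opprD addrACA -mulrBr mulrDr mulrCA.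
Qed.

Lemma omega_alt (u v w : vec) : omega u v w = - omega v u w.
Proof.
rewrite /omega cross_anti /dot -sumrN.
by apply: eq_bigr => i _; rewrite mxE mulNr.
Qed.

Lemma omega_linl a (u v w z : vec) :
  omega (a *: u + v) w z = a * omega u w z + omega v w z.
Proof.
rewrite /omega cross_linl /dot mulr_sumr -big_split; apply: eq_bigr => i _.
by rewrite !mxE /= mulrDl mulrA.
Qed.

Lemma omega_sum1 (u v w : vec) :
  omega u v w = \sum_i u 0 i * omega (delta_mx 0 i) v w.
Proof.
have omega0 : omega 0 v w = 0.
  by have := omega_linl (-1) 0 0 v w; rewrite scaler0 addr0 mulN1r addNr.
rewrite {1}[u]row_sum_delta.
elim/big_rec2: _ => [//|i x y _ <-]; exact: omega_linl.
Qed.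

Lemma omega_sum2 (u v w : vec) :
  omega u v w =
  \sum_i \sum_j (u 0 i * v 0 j) * omega (delta_mx 0 i) (delta_mx 0 j) w.
Proof.
rewrite omega_sum1; apply: eq_bigr => i _.
rewrite omega_alt omega_sum1 -sumrN mulr_sumr; apply: eq_bigr => j _.
by rewrite omega_alt !mulrN opprK mulrA.
Qed.

Lemma interior_product_wedge (u v w : vec) :
  interior_product (wedge u v) w = omega u v w.
Proof.
transitivity (2^-1 * (omega u v w - omega v u w)).
  rewrite /interior_product (omega_sum2 u v) (omega_sum2 v u) -sumrB.
  congr (_ * _); apply: eq_bigr => i _; rewrite -sumrB.
  apply: eq_bigr => j _.
  by rewrite -mulrBl /wedge !mxE !big_ord1 !mxE.
rewrite (omega_alt v u) opprK -mulr2n.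
by rewrite -[omega _ _ _ *+ 2]mulr_natl mulKf// pnatr_eq0.
Qed.

End Facts.

(* Main.v *)
From HB Require Import structures.
Require Import Defs.
From mathcomp Require Import all_boot all_order all_algebra.
From mathcomp Require Import all_classical all_reals all_analysis.
From mathcomp Require Import ring.
Set Implicit Arguments.
Unset Strict Implicit.
Unset Printing Implicit Defensive.
Import Order.TTheory GRing.Theory Num.Theory.
Import numFieldNormedType.Exports.
Local Open Scope classical_set_scope.
Local Open Scope ring_scope.

(** Everything rests on one identity of the seven-dimensional cross product,
[u x (u x v) = <u,v> u - <u,u> v] ([cross_cross]).  It is equivalent to a
contraction identity of the structure constants [eps], which are integers
indexed by a finite set, so that it can be settled by evaluating all cases.

For (i), the identity gives [X x JX = X x (p x X) = <X,X> p - <X,p> X], which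
is normal to the sphere at [p] when [X] is tangent; hence [X /\ JX] contracts
with [omega] to zero on tangent vectors ([omega_J]).  A function [H] that is
constant on the sphere has zero differential there, and this is the equation
of Hamilton, de Donder and Weyl.

For (ii), write [Y = U /\ V].  That [Y] contracts to zero says that [U x V] is
normal, [U x V = lam p].  Taking the cross product with [U] once more,
[<U,V> U - <U,U> V = lam U x p = - lam JU], and wedging with [U] leaves
[<U,U> U /\ V = lam U /\ JU] ([wedge_J_of_cross_normal]).  Where [Y] does not
vanish, neither [U] nor [lam] does, and [X = sqrt (|lam| / <U,U>) U] satisfies
[Y = sg lam X /\ JX].

The smoothness of [X] is local.  Around a given point replace [U], [V] by smooth
extensions to an open set of the ambient space and [|lam|] by [s lam], where [s]
is the sign of [lam] at that point; on the open set where [s lam] and [<U,U>]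
are positive, the formula for [X] is built from smooth functions by products,
inverses of nonvanishing functions and square roots of positive ones.  The
closure of the class C^n under these operations ([Cn_mul], [Cn_inv],
[Cn_sqrt]) is an induction on [n], since each rule of differentiation expresses
the derivative of the result through the same operation one order lower. *)

(** * The structure constants of the octonions *)

(** The structure constants with integer values: unlike [oct_eps R] for an
abstract [R], these can be evaluated. *)
Definition eps_int (i j k : nat) : int :=
  if oct_cyclic i j k then 1 else if oct_cyclic j i k then - 1 else 0.

Lemma all_iota_ord n (P : pred nat) : all P (iota 0 n) -> forall i : 'I_n, P i.
Proof. by move=> /allP aP i; apply: aP; rewrite mem_iota ltn_ord. Qed.

Lemma eps_int_anti (i j k : 'I_7) :
  eps_int i.+1 j.+1 k.+1 = - eps_int j.+1 i.+1 k.+1.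
Proof.
have chk : all (fun i => all (fun j => all (fun k =>
   eps_int i.+1 j.+1 k.+1 == - eps_int j.+1 i.+1 k.+1)
   (iota 0 7)) (iota 0 7)) (iota 0 7).
  by vm_compute.
apply/eqP.
by move/all_iota_ord/(_ i)/all_iota_ord/(_ j)/all_iota_ord: chk.
Qed.

(** The coefficient form of [u x (u x v) = <u,v> u - <u,u> v].  The left side is
symmetrized in [l] and [i], the two slots that receive the same vector [u]:
without the symmetrization the contraction has an additional alternating part
and is not expressible by Kronecker symbols. *)
Lemma eps_int_contract (l i j m : 'I_7) :
  \sum_(k < 7) (eps_int i.+1 j.+1 k.+1 * eps_int l.+1 k.+1 m.+1
              + eps_int l.+1 j.+1 k.+1 * eps_int i.+1 k.+1 m.+1) =
  (i == j)%:R * (l == m)%:R + (l == j)%:R * (i == m)%:R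
  - 2 * ((l == i)%:R * (j == m)%:R).
Proof.
pose T (l i j m k : nat) := eps_int i.+1 j.+1 k.+1 * eps_int l.+1 k.+1 m.+1
  + eps_int l.+1 j.+1 k.+1 * eps_int i.+1 k.+1 m.+1.
pose D (l i j m : nat) : int := (i == j)%:R * (l == m)%:R
  + (l == j)%:R * (i == m)%:R - 2 * ((l == i)%:R * (j == m)%:R).
(* As a fold over an explicit list the sum becomes a term that evaluates. *)
rewrite -(big_mkord xpredT (T l i j m)) /index_iota subn0 unlock.
rewrite -[RHS]/(D l i j m); apply/eqP.
have chk : all (fun l => all (fun i => all (fun j => all (fun m =>
   reducebig 0 (iota 0 7) (fun k => BigBody k +%R true (T l i j m k)) ==
   D l i j m) (iota 0 7)) (iota 0 7)) (iota 0 7)) (iota 0 7).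
  by vm_compute.
move/all_iota_ord/(_ l)/all_iota_ord/(_ i): chk.
by move/all_iota_ord/(_ j)/all_iota_ord.
Qed.

(** * The cross product *)

Section CrossProduct.
Variable R : realType.
Implicit Types u v w : 'rV[R]_7.

Lemma oct_epsE i j k : oct_eps R i j k = (eps_int i j k)%:~R.
Proof. by rewrite /oct_eps /eps_int; do 2?case: ifP => _. Qed.

Lemma oct_mulE (u v : 'rV[R]_7) (k : 'I_7) :
  oct_mul (oct_of_vec u) (oct_of_vec v) 0 (lift 0 k) =
  \sum_i \sum_j u 0 i * v 0 j * (eps_int i.+1 j.+1 k.+1)%:~R.
Proof.
rewrite /oct_mul summxE big_ord_recl summxE big1 ?add0r => [|j _]; last first.
  by rewrite !mxE unlift_none !mul0r.
apply: eq_bigr => i _; rewrite summxE big_ord_recl.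
rewrite [X in X + _]mxE [oct_of_vec v _ _]mxE unlift_none mulr0 mul0r add0r.
apply: eq_bigr => j _; rewrite mxE ![oct_of_vec _ _ _]mxE !liftK -oct_epsE.
congr (_ * _); rewrite /oct_basis_mul /=.
rewrite 3!mxE mulr0 add0r summxE (bigD1 (lift 0 k)) //=.
rewrite 2!mxE !eqxx mulr1 big1 ?addr0 // => l /andP[_ lk].
by rewrite !mxE eq_sym (negbTE lk) mulr0.
Qed.

(** By antisymmetry of the structure constants the commutator doubles each term,
which the factor one half undoes. *)
Lemma crossE u v k : cross u v 0 k =
  \sum_i \sum_j u 0 i * v 0 j * (eps_int i.+1 j.+1 k.+1)%:~R.
Proof.
rewrite !mxE !oct_mulE [X in _ - X]exchange_big /=.
rewrite -sumrB mulr_sumr; apply: eq_bigr => i _.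
rewrite -sumrB mulr_sumr; apply: eq_bigr => j _.
rewrite [in X in _ - X]eps_int_anti rmorphN mulrN opprK (mulrC (v 0 j)) -mulr2n.
by rewrite -[_ * _ *+ 2]mulr_natl mulKf // pnatr_eq0.
Qed.

Lemma sum_delta (F : 'I_7 -> R) j : \sum_i (i == j)%:R * F i = F j.
Proof.
rewrite (bigD1 j) //= eqxx mul1r big1 ?addr0 // => i /negbTE ->.
by rewrite mul0r.
Qed.

Lemma cross_cross u v : cross u (cross u v) = dot u v *: u - dot u u *: v.
Proof.
apply/rowP => m.
pose E (i j k : 'I_7) : R := (eps_int i.+1 j.+1 k.+1)%:~R.
pose S (l i j k : 'I_7) := u 0 l * u 0 i * v 0 j * (E i j k * E l k m).
have lhs : cross u (cross u v) 0 m = \sum_l \sum_i \sum_j \sum_k S l i j k.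
  rewrite crossE; apply: eq_bigr => l _.
  under eq_bigr => k _.
    rewrite crossE mulr_sumr mulr_suml; under eq_bigr => i _.
      rewrite mulr_sumr mulr_suml; over.
    over.
  rewrite exchange_big; apply: eq_bigr => i _ /=.
  rewrite exchange_big; apply: eq_bigr => j _ /=; apply: eq_bigr => k _.
  by rewrite /S /E !mulrA.
have two0 : 2%:R != 0 :> R by rewrite pnatr_eq0.
(* Doubling produces the two terms that the symmetrized contraction needs. *)
apply: (mulfI two0); rewrite mulr_natl mulr2n {2}lhs exchange_big lhs /=.
rewrite -big_split /=.
have contract l i j : \sum_k S l i j k + \sum_k S i l j k =
    u 0 l * u 0 i * v 0 j * ((i == j)%:R * (l == m)%:R
      + (l == j)%:R * (i == m)%:R - 2 * ((l == i)%:R * (j == m)%:R)).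
  pose D : int := (i == j)%:R * (l == m)%:R
    + (l == j)%:R * (i == m)%:R - 2 * ((l == i)%:R * (j == m)%:R).
  rewrite [X in _ * X](_ : _ = D%:~R); last first.
    by rewrite /D rmorphB rmorphD !rmorphM /= !rmorph_nat.
  rewrite /D -eps_int_contract rmorph_sum mulr_sumr -big_split /=.
  apply: eq_bigr => k _.
  by rewrite /S /E (mulrC (u 0 i) (u 0 l)) -mulrDr rmorphD !rmorphM.
(* The factors are arranged so that each Kronecker symbol stands in front of the
   sum that it collapses. *)
transitivity (\sum_l \sum_i \sum_j
    ((l == m)%:R * (u 0 l * ((j == i)%:R * (u 0 i * v 0 j)))
     + (i == m)%:R * (u 0 i * ((j == l)%:R * (u 0 l * v 0 j)))
     - ((i == l)%:R * (u 0 l * u 0 i * ((j == m)%:R * v 0 j))) *+ 2)).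
  apply: eq_bigr => l _; rewrite -big_split; apply: eq_bigr => i _ /=.
  rewrite -big_split; apply: eq_bigr => j _ /=; rewrite contract.
  rewrite (eq_sym j i) (eq_sym j l) (eq_sym i l); ring.
under eq_bigr => l _.
  under eq_bigr => i _.
    rewrite sumrB big_split -!mulr_sumr sumrMnl -!mulr_sumr !sum_delta.
    over.
  rewrite sumrB big_split -!mulr_sumr sumrMnl !sum_delta.
  over.
rewrite sumrB big_split -!mulr_sumr sumrMnl !sum_delta -mulr_suml !mxE /dot /=.
ring.
Qed.

Lemma omegaE u v w : omega u v w =
  \sum_i \sum_j \sum_k u 0 i * v 0 j * w 0 k * (eps_int i.+1 j.+1 k.+1)%:~R.
Proof.
rewrite /omega /dot; under eq_bigr => k _.
  rewrite crossE mulr_suml; under eq_bigr => i _ do rewrite mulr_suml.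
  over.
rewrite exchange_big; apply: eq_bigr => i _ /=.
rewrite exchange_big; apply: eq_bigr => j _ /=.
by apply: eq_bigr => k _; rewrite mulrAC.
Qed.

Lemma eps_int_cyclic i j k : eps_int i j k = eps_int j k i.
Proof.
have cyc a b c : oct_cyclic a b c = oct_cyclic b c a.
  by rewrite /oct_cyclic orbC -orbA.
by rewrite /eps_int cyc (cyc k j i) (cyc j i k).
Qed.

Lemma omega_cyclic u v w : omega u v w = omega v w u.
Proof.
rewrite !omegaE exchange_big; apply: eq_bigr => j _ /=.
rewrite exchange_big; apply: eq_bigr => k _ /=; apply: eq_bigr => i _.
by rewrite eps_int_cyclic -(mulrA (u 0 i)) (mulrC (u 0 i)).
Qed.

Lemma dotC u v : dot u v = dot v u.
Proof. by apply: eq_bigr => i _; rewrite mulrC. Qed.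

(** Cyclic symmetry of the form turns [<p, p x u>] into [omega p p u]. *)
Lemma dot_cross_self p u : dot p (cross p u) = 0.
Proof.
have /eqP := omega_alt p p u; rewrite -addr_eq0 -mulr2n mulrn_eq0 /=.
by rewrite omega_cyclic => /eqP; rewrite dotC.
Qed.
End CrossProduct.

(** * Bivectors on the sphere annihilated by omega *)

Section Geometry.
Variable R : realType.
Implicit Types (p u v w : 'rV[R]_7) (a : R).

Lemma dot_linl a u v w : dot (a *: u + v) w = a * dot u w + dot v w.
Proof.
rewrite /dot mulr_sumr -big_split; apply: eq_bigr => i _ /=.
by rewrite !mxE mulrDl mulrA.
Qed.

Lemma dotZl a u v : dot (a *: u) v = a * dot u v.
Proof. by rewrite /dot mulr_sumr; apply: eq_bigr => i _; rewrite mxE mulrA. Qed.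

Lemma dot_ge0 u : 0 <= dot u u.
Proof. by apply: sumr_ge0 => i _; rewrite -expr2 sqr_ge0. Qed.

Lemma dot_eq0 u : (dot u u == 0) = (u == 0).
Proof.
apply/idP/eqP => [|->]; last first.
  by rewrite /dot big1 // => i _; rewrite mxE mul0r.
rewrite psumr_eq0 => [/allP u0|i _]; last by rewrite -expr2 sqr_ge0.
apply/rowP => i; have := u0 i (mem_index_enum _).
by rewrite mulf_eq0 orbb mxE => /eqP.
Qed.

Lemma S6E p : S6 p <-> dot p p = 1.
Proof.
rewrite /S6 /enorm /=; split=> [p1|->]; last exact: sqrtr1.
by rewrite -(sqr_sqrtr (dot_ge0 p)) p1 expr1n.
Qed.

Lemma S6_normalize p : p != 0 -> S6 ((enorm p)^-1 *: p).
Proof.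
move=> p0; apply/S6E; rewrite dotZl dotC dotZl mulrA -invfM -expr2.
by rewrite sqr_sqrtr ?dot_ge0 // mulVf // dot_eq0.
Qed.

Lemma tangent_J p u : tangent p (J p u).
Proof. exact: dot_cross_self. Qed.

Lemma crossZr a u v : cross u (a *: v) = a *: cross u v.
Proof.
rewrite cross_anti [in RHS]cross_anti -[a *: v]addr0 cross_linl.
suff -> : cross 0 u = 0 by rewrite addr0 scalerN.
by apply/rowP => i; have /rowP/(_ i) := cross_linl (-1) 0 0 u;
  rewrite scaler0 addr0 scaleN1r addNr.
Qed.

Lemma wedgeZr a u v : wedge u (a *: v) = a *: wedge u v.
Proof.
by rewrite /wedge -scalemxAr [(a *: v)^T]linearZ /= -scalemxAl scalerBr.
Qed.

Lemma wedgeZl a u v : wedge (a *: u) v = a *: wedge u v.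
Proof.
by rewrite /wedge -scalemxAr [(a *: u)^T]linearZ /= -scalemxAl scalerBr.
Qed.

Lemma wedgeDr u v w : wedge u (v + w) = wedge u v + wedge u w.
Proof.
by rewrite /wedge [(v + w)^T]linearD /= mulmxDr mulmxDl opprD addrACA.
Qed.

Lemma wedge_self u : wedge u u = 0.
Proof. exact: subrr. Qed.

(** [u x (p x u) = <u,u> p - <u,p> u] is normal to the sphere at [p]. *)
Lemma omega_J p u w : tangent p u -> tangent p w -> omega u (J p u) w = 0.
Proof.
rewrite /tangent /= => pu pw; rewrite /omega /J cross_anti.
rewrite [cross p u]cross_anti -[- cross u p]scaleN1r -cross_anti crossZr.
rewrite cross_cross (dotC u p) pu scale0r sub0r scaleN1r opprK dotZl pw.
by rewrite mulr0.
Qed.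

(** The tangential part of [c] is itself a tangent vector, hence orthogonal to
[c], hence to itself. *)
Lemma normal_of_orthogonal_tangent p c : S6 p ->
  (forall w, tangent p w -> dot c w = 0) -> c = dot c p *: p.
Proof.
move=> /S6E p1 cT; set w := - dot c p *: p + c.
have pw : tangent p w.
  by rewrite /tangent /= dotC dot_linl p1 mulr1 addNr.
have : dot w w == 0.
  by rewrite {1}/w dot_linl (cT _ pw) (pw : dot p w = 0) mulr0 addr0.
by rewrite dot_eq0 /w scaleNr addrC subr_eq0 => /eqP.
Qed.

(** A second cross product with [u] solves [u x v = lam p] for [v] up to a
multiple of [u], which the wedge with [u] kills. *)
Lemma wedge_J_of_cross_normal p u v lam : tangent p u ->
  cross u v = lam *: p -> dot u u *: wedge u v = lam *: wedge u (J p u).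
Proof.
move=> pu uv.
have E : dot u u *: v = dot u v *: u + lam *: J p u.
  have := cross_cross u v; rewrite uv crossZr cross_anti scalerN => E.
  by rewrite -[lam *: _]opprK E opprB addrC subrK.
by rewrite -!wedgeZr E wedgeDr wedgeZr wedge_self scaler0 add0r.
Qed.

Lemma wedge_J_scale a p u :
  wedge (a *: u) (J p (a *: u)) = a ^+ 2 *: wedge u (J p u).
Proof. by rewrite /J crossZr wedgeZl wedgeZr scalerA. Qed.

End Geometry.

(** * Calculus of C^n maps *)

Section CnCalculus.
Variables (R : realType) (V : normedModType R).

(** Derivation rules hold only where the maps are differentiable, that is, on the
open set in question; the inductions below therefore need that [Cn] depends
only on the values there ([Cn_eq]), and this is its first-order ingredient. *)
Lemma near_eq_differentiable (W : normedModType R) (f g : V -> W) x :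
  (\near x, f x = g x) -> differentiable f x -> differentiable g x.
Proof.
move=> fg /diff_locallyP[df0 dfE].
have gE : g \o shift x = cst (g x) + 'd f x +o_ 0 id.
  apply/eqaddoP => _/posnumP[e].
  have /eqaddoP/(_ e%:num)/(_ [gt0 of e%:num]) := dfE.
  have fg0 : \forall y \near (0 : V), f (y + x) = g (y + x).
    by move: fg; rewrite (near_shift 0 x) /= subr0.
  apply: filter_app; near=> h.
  have fgh : f (h + x) = g (h + x) by near: h.
  by rewrite !fctE /= fgh -(nbhs_singleton fg).
by apply/diff_locallyP; rewrite (diff_unique df0 gE).
Unshelve. all: by end_near. Qed.

Lemma Cn_subset (W : normedModType R) n (O O' : set V) (f : V -> W) :
  O' `<=` O -> Cn n O f -> Cn n O' f.
Proof.
move=> OO; elim: n f => [|n IH] f /=; first by move=> fO x /OO /fO.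
by case=> df Df; split=> [x /OO /df //|v]; apply: IH.
Qed.

Lemma Cn_eq (W : normedModType R) n (O : set V) (f g : V -> W) :
  open O -> (forall x, O x -> f x = g x) -> Cn n O f -> Cn n O g.
Proof.
move=> oO; elim: n f g => [|n IH] f g fg /=.
  move=> fO x Ox; have fgx : \near x, f x = g x.
    by near=> y; apply: fg; near: y; exact: open_nbhs_nbhs.
  rewrite /prop_for /continuous_at -(fg _ Ox); apply: cvg_trans (fO x Ox).
  exact: near_eq_cvg.
have nfg x : O x -> \near x, f x = g x.
  by move=> Ox; near=> y; apply: fg; near: y; exact: open_nbhs_nbhs.
case=> df Df; split=> [x Ox|v].
  exact: near_eq_differentiable (nfg _ Ox) (df x Ox).
by apply: IH (Df v) => x /nfg; exact: near_eq_derive.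
Unshelve. all: by end_near. Qed.

Lemma CnW (W : normedModType R) n (O : set V) (f : V -> W) :
  Cn n.+1 O f -> Cn n O f.
Proof.
elim: n f => [|n IH] f [df Df].
  by move=> x /df; exact: differentiable_continuous.
by split=> // v; apply: IH.
Qed.

Lemma Cn_cst (W : normedModType R) n (O : set V) (c : W) : Cn n O (cst c).
Proof.
elim: n c => [|n IH] c /=; first by move=> x _; exact: cst_continuous.
split=> [x _|v]; first exact: differentiable_cst.
rewrite (_ : (fun _ => _) = cst 0) //; apply/funext => x.
exact: derive_cst.
Qed.

Lemma Cn_add (W : normedModType R) n (O : set V) (f g : V -> W) : open O ->
  Cn n O f -> Cn n O g -> Cn n O (f + g).
Proof.
move=> oO; elim: n f g => [|n IH] f g.
  by move=> fO gO x Ox; apply: cvgD; [exact: fO|exact: gO].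
move=> [df Df] [dg Dg]; split=> [x Ox|v].
  by apply: differentiableD; [exact: df|exact: dg].
apply: Cn_eq (IH _ _ (Df v) (Dg v)) => // x Ox.
by rewrite deriveD //; apply: diff_derivable; [exact: df|exact: dg].
Qed.

Lemma Cn_sum (W : normedModType R) n (O : set V) (I : finType)
    (F : I -> V -> W) : open O ->
  (forall i, Cn n O (F i)) -> Cn n O (fun x => \sum_i F i x).
Proof.
move=> oO FO; rewrite (_ : (fun _ => _) = \sum_i F i); last first.
  by apply/funext => x; rewrite fct_sumE.
by apply: (big_ind (Cn n O)) => // [|f g]; [exact: Cn_cst|exact: Cn_add].
Qed.

Lemma Cn_linear (W W' : normedModType R) n (O : set V)
    (L : {linear W -> W'}) (f : V -> W) : open O -> continuous L ->
  Cn n O f -> Cn n O (L \o f).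
Proof.
move=> oO cL; elim: n f => [|n IH] f.
  by move=> fO x Ox; apply: continuous_comp; [exact: fO|exact: cL].
move=> [df Df]; split=> [x Ox|v].
  by apply: differentiable_comp; [exact: df|exact: linear_differentiable].
apply: Cn_eq (IH _ (Df v)) => // x Ox.
have dfx := df _ Ox; have dLf := linear_differentiable (f x) cL.
rewrite deriveE; last exact: differentiable_comp.
by rewrite diff_comp //= diff_lin // deriveE.
Qed.

Lemma Cn_mul n (O : set V) (f g : V -> R) : open O ->
  Cn n O f -> Cn n O g -> Cn n O (f * g).
Proof.
move=> oO; elim: n f g => [|n IH] f g.
  by move=> fO gO x Ox; apply: cvgM; [exact: fO|exact: gO].
move=> [df Df] [dg Dg]; split=> [x Ox|v].
  by apply: differentiableM; [exact: df|exact: dg].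
have fO : Cn n O f by apply: CnW.
have gO : Cn n O g by apply: CnW.
apply: Cn_eq (Cn_add oO (IH _ _ fO (Dg v)) (IH _ _ gO (Df v))) => // x Ox.
by rewrite deriveM //; apply: diff_derivable; [exact: df|exact: dg].
Qed.

Lemma Cn_opp n (O : set V) (f : V -> R) : open O -> Cn n O f -> Cn n O (- f).
Proof.
move=> oO fO; have cO : Cn n O (cst (-1 : R)) by exact: Cn_cst.
apply: Cn_eq (Cn_mul oO cO fO) => // x _.
exact: mulN1r.
Qed.

Lemma Cn_inv n (O : set V) (f : V -> R) :
  open O -> (forall x, O x -> f x != 0) ->
  Cn n O f -> Cn n O (fun x => (f x)^-1).
Proof.
move=> oO f0; elim: n => [|n IH].
  by move=> fO x Ox; apply: cvgV; [exact: f0|exact: fO].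
move=> /[dup] /CnW/IH fV [df Df]; split=> [x Ox|v].
  by apply: differentiableV; [exact: df|exact: f0].
apply: Cn_eq (Cn_mul oO (Cn_opp oO (Cn_mul oO fV fV)) (Df v)) => // x Ox.
rewrite deriveV; [|exact: f0|by apply: diff_derivable; exact: df].
by rewrite -exprVn expr2.
Qed.

(** The derivative of the root of [f] is [f' / (2 sqrt f)], where only the root
of [f] at one order lower occurs. *)
Lemma Cn_sqrt n (O : set V) (f : V -> R) :
  open O -> (forall x, O x -> 0 < f x) ->
  Cn n O f -> Cn n O (fun x => Num.sqrt (f x)).
Proof.
move=> oO f0; elim: n => [|n IH].
  by move=> fO x Ox; apply: continuous_comp; [exact: fO|exact: sqrt_continuous].
move=> /[dup] /CnW/IH fs [df Df].
have ds x : O x -> differentiable (Num.sqrt : R -> R) (f x).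
  move=> Ox; apply/derivable1_diffP.
  by have [] := is_derive1_sqrt (f0 _ Ox).
split=> [x Ox|v].
  by apply: (@differentiable_comp _ _ _ _ f); [exact: df|exact: ds].
have s0 x : O x -> 2 * Num.sqrt (f x) != 0.
  by move=> Ox; rewrite mulf_neq0 // gt_eqF // sqrtr_gt0 f0.
have cO : Cn n O (cst (2 : R)) by exact: Cn_cst.
have fsV := Cn_inv oO s0 (Cn_mul oO cO fs).
apply: Cn_eq (Cn_mul oO (Df v) fsV) => // x Ox.
have dfx := df _ Ox; have dsx := ds _ Ox.
have dsE : 'd Num.sqrt (f x) ('D_v f x) = 'D_v f x * (2 * Num.sqrt (f x))^-1.
  rewrite -(derive_sqrt (f0 _ Ox)) (deriveE (1 : R) dsx).
  by rewrite -[in LHS](mulr1 ('D_v f x)) linearZ.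
rewrite [RHS]deriveE; last exact: (@differentiable_comp _ _ _ _ f).
by rewrite (@diff_comp _ _ _ _ f) //= -(deriveE v dfx) dsE.
Qed.

Lemma Cn_scale (W : normedModType R) n (O : set V) (f : V -> R) (w : W) :
  open O -> Cn n O f -> Cn n O (fun x => f x *: w).
Proof.
move=> oO fO.
have lin : linear ( *:%R ^~ w : R -> W).
  by move=> a u v; rewrite scalerDl scalerA.
pose L : {linear R -> W} :=
  HB.pack ( *:%R ^~ w : R -> W) (GRing.isLinear.Build _ _ _ _ _ lin).
exact: (Cn_linear (L := L) oO (@scalel_continuous _ _ w) fO).
Qed.

Lemma Cn_coord n (O : set V) p q (f : V -> 'M[R]_(p.+1, q.+1)) i j : open O ->
  Cn n O f -> Cn n O (fun x => f x i j).
Proof.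
move=> oO fO.
have lin : linear (fun M : 'M[R]_(p.+1, q.+1) => M i j : R).
  by move=> a u v; rewrite !mxE.
pose L : {linear 'M[R]_(p.+1, q.+1) -> R} :=
  HB.pack (fun M : 'M[R]_(p.+1, q.+1) => M i j : R)
    (GRing.isLinear.Build _ _ _ _ _ lin).
exact: (Cn_linear (L := L) oO (@coord_continuous _ _ _ i j) fO).
Qed.

Lemma Cn_mx n (O : set V) p q (f : V -> 'M[R]_(p.+1, q.+1)) : open O ->
  (forall i j, Cn n O (fun x => f x i j)) -> Cn n O f.
Proof.
move=> oO fO.
have sO i j := Cn_scale (delta_mx i j : 'M[R]_(p.+1, q.+1)) oO (fO i j).
apply: Cn_eq (Cn_sum oO (fun i => Cn_sum oO (sO i))) => // x _.
by rewrite [RHS]matrix_sum_delta.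
Qed.

End CnCalculus.

(** * Smoothness of the vector operations *)

Section SmoothFields.
Variables (R : realType) (V : normedModType R).
Local Notation vec := 'rV[R]_7.

Lemma Cn_id n (O : set V) : Cn n O id.
Proof.
case: n => [|n]; first by move=> x _.
split=> [x _|v]; first exact: ex_diff.
rewrite (_ : (fun _ => _) = cst v); first exact: Cn_cst.
by apply/funext => x; exact: derive_id.
Qed.

Lemma Cn_dot n (O : set V) (f g : V -> vec) : open O ->
  Cn n O f -> Cn n O g -> Cn n O (fun x => dot (f x) (g x)).
Proof.
move=> oO fO gO; apply: (Cn_sum (F := fun i x => f x 0 i * g x 0 i)) => // i.
by apply: Cn_mul => //; apply: Cn_coord.
Qed.

Lemma Cn_cross n (O : set V) (f g : V -> vec) : open O ->
  Cn n O f -> Cn n O g -> Cn n O (fun x => cross (f x) (g x)).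
Proof.
move=> oO fO gO; apply: Cn_mx => // a k; rewrite (ord1 a).
under eq_fun do rewrite crossE.
pose c i j : R := (eps_int i j k.+1)%:~R.
apply: (Cn_sum (F := fun i x => \sum_j f x 0 i * g x 0 j * c i.+1 j.+1)) => //.
move=> i.
apply: (Cn_sum (F := fun j x => f x 0 i * g x 0 j * c i.+1 j.+1)) => // j.
apply: Cn_mul => //; last exact: Cn_cst.
by apply: Cn_mul => //; apply: Cn_coord.
Qed.

Lemma Cn_wedge n (O : set V) (f g : V -> vec) : open O ->
  Cn n O f -> Cn n O g -> Cn n O (fun x => wedge (f x) (g x)).
Proof.
move=> oO fO gO; apply: Cn_mx => // i j.
have cO h k : Cn n O h -> Cn n O (fun x => (h x : vec) 0 k) by exact: Cn_coord.
rewrite (_ : (fun _ => _) =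
  (fun x => f x 0 i * g x 0 j + - (g x 0 i * f x 0 j))).
  by apply: Cn_add => //; [|apply: Cn_opp => //]; apply: Cn_mul => //; apply: cO.
by apply/funext => x; rewrite !mxE !big_ord1 !mxE.
Qed.

Lemma Cn_scale_fun n (O : set V) (f : V -> R) (g : V -> vec) : open O ->
  Cn n O f -> Cn n O g -> Cn n O (fun x => f x *: g x).
Proof.
move=> oO fO gO; apply: Cn_mx => // i j.
under eq_fun do rewrite mxE.
by apply: Cn_mul => //; apply: Cn_coord.
Qed.

Lemma open_setI_pos (O : set V) (f : V -> R) : open O -> Cn 0 O f ->
  open (O `&` [set x | 0 < f x]).
Proof.
move=> oO fO; rewrite openE => x [Ox fx0].
apply: filterI; first exact: open_nbhs_nbhs.
exact: (cvgr_gt (f x) (fO x Ox)).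
Qed.
End SmoothFields.

(** * The fields [X /\ JX] and the square root of a bivector field *)

Section Fields.
Variable R : realType.
Local Notation vec := 'rV[R]_7.

Lemma wedgeJ_bivector_field (A : set vec) (X : vec -> vec) :
  vector_field A X -> bivector_field A (wedgeJ X).
Proof.
move=> [Xt Xs]; split=> [p Ap|p Ap].
  exists 1%N, (fun=> X p), (fun=> J p (X p)); split; last by rewrite big_ord1.
  by move=> _; split; [exact: Xt|exact: tangent_J].
have [N [F [oN Np FN FX]]] := Xs p Ap.
exists N, (fun x => wedge (F x) (cross x (F x))); split=> // [n|x Ax Nx].
  by apply: Cn_wedge => //; apply: Cn_cross => //; exact: Cn_id.
by rewrite FX.
Qed.

(** Near a point of the sphere the radial extension of [H] is defined through
nonzero vectors, so it is locally constant there. *)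
Lemma dS6_cst (H : vec -> R) c p w : (forall q, S6 q -> H q = c) -> S6 p ->
  dS6 H p w = 0.
Proof.
move=> Hc /S6E p1; have p0 : p != 0 by rewrite -dot_eq0 p1 oner_eq0.
rewrite /dS6 -(derive_cst c p w); apply: near_eq_derive.
near=> x; apply/Hc/S6_normalize.
by near: x; exact: (cvgr_neq0 p).
Unshelve. all: by end_near. Qed.

Lemma interior_wedgeJ (X : vec -> vec) p w : vector_field (@S6 R) X ->
  S6 p -> tangent p w -> interior_product (wedgeJ X p) w = 0.
Proof.
move=> [Xt _] Sp pw; rewrite interior_product_wedge.
by apply: omega_J => //; exact: Xt.
Qed.

Definition normal_part (U V : vec -> vec) (p : vec) : R :=
  dot (cross (U p) (V p)) p.

(** The vector field [X] of part (ii), with [X /\ JX] equal to [U /\ V] up to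
sign. *)
Definition root_field (U V : vec -> vec) (p : vec) : vec :=
  Num.sqrt (`|normal_part U V p| / dot (U p) (U p)) *: U p.

(** The absolute value is smooth away from zero because near each point it is the
product with a constant sign. *)
Lemma smooth_root_field (A B : set vec) (U V : vec -> vec) :
  B `<=` A -> smooth_on A U -> smooth_on A V ->
  (forall p, B p -> U p != 0 /\ normal_part U V p != 0) ->
  smooth_on B (root_field U V).
Proof.
move=> BA Us Vs B0 p Bp; have [Up0 lp0] := B0 _ Bp.
have [OU [FU [oU OUp FUC FUE]]] := Us p (BA _ Bp).
have [OV [FV [oV OVp FVC FVE]]] := Vs p (BA _ Bp).
pose s := Num.sg (normal_part U V p).
pose lam x := s * normal_part FU FV x.
pose q x := dot (FU x) (FU x).
pose O1 := OU `&` OV; have oO1 : open O1 by exact: openI.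
have FU1 n : Cn n O1 FU by apply: Cn_subset (FUC n) => x [].
have FV1 n : Cn n O1 FV by apply: Cn_subset (FVC n) => x [].
have qC n : Cn n O1 q by apply: Cn_dot.
have lamC n : Cn n O1 lam.
  apply: Cn_mul => //; first exact: Cn_cst.
  by apply: Cn_dot => //; [exact: Cn_cross|exact: Cn_id].
(* The squared norm [q] is nonnegative, so that positivity of the product makes
   both factors positive. *)
pose O := O1 `&` [set x | 0 < lam x * q x].
have oO : open O by apply: open_setI_pos => //; apply: Cn_mul.
have O1E x : A x -> O1 x -> FU x = U x /\ FV x = V x.
  by move=> Ax [OUx OVx]; rewrite FUE // FVE.
have lam_q x : O x -> 0 < lam x /\ 0 < q x.
  case=> _ /= lq; have : 0 <= q x by exact: dot_ge0.
  rewrite le_eqVlt => /predU1P[q0|q0]; first by rewrite -q0 mulr0 ltxx in lq.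
  by split=> //; rewrite -(pmulr_lgt0 _ q0).
exists O, (fun x => Num.sqrt (lam x * (q x)^-1) *: FU x); split=> //.
- split=> //=; have [FUp FVp] := O1E p (BA _ Bp) (conj OUp OVp).
  rewrite /lam /q /normal_part FUp FVp -/(normal_part U V p) -normrEsg.
  by rewrite mulr_gt0 // ?normr_gt0 // lt_def dot_eq0 Up0 dot_ge0.
- move=> n; have OO1 : O `<=` O1 by move=> x [].
  apply: Cn_scale_fun => //; last exact: Cn_subset (FU1 n).
  apply: Cn_sqrt => // [x /lam_q[? ?]|]; first by rewrite divr_gt0.
  apply: Cn_mul => //; first exact: Cn_subset (lamC n).
  apply: Cn_inv => // [x /lam_q[_ /lt0r_neq0]//|].
  exact: Cn_subset (qC n).
- move=> x Bx Ox; have [FUx FVx] := O1E x (BA _ Bx) Ox.1.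
  have [lx _] := lam_q x Ox.
  suff lamE : lam x = `|normal_part U V x|.
    by rewrite lamE /q FUx.
  rewrite -(gtr0_norm lx) normrM normr_sg lp0 mul1r.
  by rewrite /normal_part FUx FVx.
Qed.

Lemma wedge_root_field (U V : vec -> vec) p :
  S6 p -> tangent p (U p) ->
  (forall w, tangent p w -> omega (U p) (V p) w = 0) ->
  wedge (U p) (V p) <> 0 ->
  [/\ U p != 0, normal_part U V p != 0 &
    wedge (U p) (V p) = Num.sg (normal_part U V p) *: wedgeJ (root_field U V) p].
Proof.
move=> Sp Ut UV0 Y0.
have UVn := normal_of_orthogonal_tangent Sp UV0.
have E := wedge_J_of_cross_normal Ut UVn.
have U0 : U p != 0.
  apply/eqP => U0; apply: Y0.
  by rewrite U0 /wedge trmx0 mul0mx mulmx0 subr0.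
have q0 : dot (U p) (U p) != 0 by rewrite dot_eq0.
have YE : wedge (U p) (V p) =
    (normal_part U V p / dot (U p) (U p)) *: wedge (U p) (J p (U p)).
  by rewrite mulrC -scalerA -E scalerA mulVf // scale1r.
split=> //.
  by apply/eqP => l0; apply: Y0; rewrite YE l0 mul0r scale0r.
rewrite /wedgeJ wedge_J_scale sqr_sqrtr ?divr_ge0 ?dot_ge0 //.
by rewrite scalerA mulrA -numEsg.
Qed.

End Fields.

(** * The proposition *)

Theorem proposition4p10 (R : realType) :
  (forall X : 'rV[R]_7 -> 'rV[R]_7, vector_field (@S6 R) X ->
     (forall p w, S6 p -> tangent p w -> interior_product (wedgeJ X p) w = 0) /\
     (forall H : 'rV[R]_7 -> R, (exists c, forall p, S6 p -> H p = c) ->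
        HDW_solution H (wedgeJ X))) /\
  (forall Y : 'rV[R]_7 -> 'M[R]_7,
     bivector_field (@S6 R) Y -> decomposable Y ->
     (forall p w, S6 p -> tangent p w -> interior_product (Y p) w = 0) ->
     exists X : 'rV[R]_7 -> 'rV[R]_7,
       vector_field [set p | S6 p /\ Y p <> 0] X /\
       forall p, S6 p -> Y p <> 0 ->
         Y p = wedgeJ X p \/ Y p = - wedgeJ X p).
Proof.
split=> [X Xvf|Y _ [U [V [[Ut Us] [_ Vs] YE]]] Y0].
  split=> [p w|H [c Hc]]; first exact: interior_wedgeJ.
  split; last 1 first.
  - by move=> p w Sp pw; rewrite (dS6_cst w Hc Sp) oppr0 interior_wedgeJ.
  - move=> p Sp; exists setT, (cst c); split=> // [|n|x Sx _].
    + exact: openT.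
    + exact: Cn_cst.
    + by rewrite Hc.
  - exact: wedgeJ_bivector_field.
have pointwise p : S6 p -> Y p <> 0 ->
    [/\ U p != 0, normal_part U V p != 0 &
      Y p = Num.sg (normal_part U V p) *: wedgeJ (root_field U V) p].
  move=> Sp; rewrite YE //; apply: wedge_root_field => // [|w pw].
    exact: Ut.
  by rewrite -interior_product_wedge -YE // Y0.
exists (root_field U V); split; last first.
  move=> p Sp Yp; have [_ l0 ->] := pointwise p Sp Yp.
  by case: sgrP l0 => //; rewrite ?scale1r ?scaleN1r; [left|right].
split=> [p [Sp Yp]|].
  rewrite /tangent /= dotC dotZl dotC.
  by have -> : dot p (U p) = 0; [exact: Ut|rewrite mulr0].
apply: smooth_root_field Us Vs _ => [p []//|p [Sp Yp]].
by have [] := pointwise p Sp Yp.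
Qed.
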